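(* Let $\{F_n\}$ be a sequence of forests, where $F_n$ has $n$ non-isolated vertices and maximum degree $\Delta = \Delta(F_n)$. Then $$ q^*(F_n) \ge 1 - 3\sqrt{\frac{\Delta}{n}}. $$
   Context: Modularity: for a graph $G$ with at least one edge and a partition $\mathcal{A} = \{A_1,\dots,A_k\}$ of $V(G)$, $$q_{\mathcal{A}}(G) = \sum_{A \in \mathcal{A}} \left( \frac{e(A)}{|E(G)|} - \frac{(\sum_{v\in A}\deg(v))^2}{4|E(G)|^2}\right),$$ where $e(A) = |\{uv \in E(G): u,v\in A\}|$ is the number of edges inside $A$. The modularity of $G$ is $q^*(G) = \max_{\mathcal{A}} q_{\mathcal{A}}(G)$, the maximum over all partitions $\mathcal{A}$ of $V(G)$. (In particular $F_n$ is assumed to have at least one edge, so $n\ge 2$.) A forest is a finite acyclic simple graph, not necessarily connected. *)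

(* Defs.v *)
From HB Require Import structures.
From mathcomp Require Import all_boot all_order all_algebra.
From mathcomp Require Import reals.

Set Implicit Arguments.
Unset Strict Implicit.
Unset Printing Implicit Defensive.

Import Order.TTheory GRing.Theory Num.Theory.
Local Open Scope ring_scope.

Record sgraph := SGraph {
  vertex :> finType;
  adj : rel vertex;
  adj_sym : symmetric adj;
  adj_irrefl : irreflexive adj }.

(* An edge uv is the unordered pair {u, v}, so each edge is counted once. *)
Definition edges (G : sgraph) : {set {set G}} :=
  [set [set u; v] | u in [set: G], v in [set: G] & adj u v].

Definition edges_in (G : sgraph) (A : {set G}) : {set {set G}} :=
  [set f in edges G | f \subset A].

Definition deg (G : sgraph) (v : G) : nat := #|[set w : G | adj v w]|.

Definition max_degree (G : sgraph) : nat := (\max_(v : G) deg v)%N.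

Definition non_isolated (G : sgraph) : {set G} :=
  [set v : G | [exists w : G, adj v w]].

(* The bound on the size is needed because [ucycle] also holds of the empty
   sequence and of [:: u; v] when u and v are adjacent. *)
Definition forest (G : sgraph) : Prop :=
  forall c : seq G, (2 < size c)%N -> ~ ucycle (@adj G) c.

Definition part_modularity (R : realType) (G : sgraph) (P : {set {set G}}) : R :=
  \sum_(A in P)
    (#|edges_in A|%:R / #|edges G|%:R
     - (\sum_(v in A) deg v)%N%:R ^+ 2 / (4 * #|edges G|%:R ^+ 2)).

(* The seed of the maximum is the value at the one-block partition, which is a
   genuine partition as soon as G has a vertex; see [modularity_attained]. *)
Definition modularity (R : realType) (G : sgraph) : R :=
  \big[Num.max/part_modularity R [set [set: G]]]_(P : {set {set G}}
      | partition P [set: G]) part_modularity R P.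

Lemma modularity_ge (R : realType) (G : sgraph) (P : {set {set G}}) :
  partition P [set: G] -> part_modularity R P <= modularity R G.
Proof. by move=> hP; rewrite /modularity; apply: le_bigmax_cond. Qed.

Lemma modularity_attained (R : realType) (G : sgraph) :
  (0 < #|G|)%N ->
  exists2 P : {set {set G}},
    partition P [set: G] & modularity R G = part_modularity R P.
Proof.
move=> G0.
have T0 : [set: G] != set0 by rewrite -card_gt0 cardsT.
have triv : partition [set [set: G]] [set: G].
  apply/and3P; split; first by rewrite /cover big_set1.
    by rewrite /trivIset /cover !big_set1.
  by rewrite in_set1 eq_sym.
rewrite /modularity; elim/big_ind: _ => [|x y [P hP ->] [Q hQ ->]|P hP].
- by exists [set [set: G]].
- by rewrite /Num.max; case: ifP => _; [exists Q|exists P].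
- by exists P.
Qed.

(* Main.v *)
Require Import Defs.
From mathcomp Require Import all_boot all_order all_algebra.
From mathcomp Require Import reals.
From mathcomp Require Import zify ring lra.
Import Order.TTheory GRing.Theory Num.Theory.
Local Open Scope ring_scope.

(** Write [D] for the sum of all degrees, which is twice the number [m] of
    edges.  For any partition the modularity is one minus the fraction of edges
    running between blocks, minus the sum of the squared block volumes over
    [D ^ 2].  If every block has volume at most [M], that last sum is at most
    [M / D].  So one wants few edges between blocks and blocks of small volume.

    In a forest both can be had, for any integer [s > 0]: there is a partition
    with at most [2 m / s] edges between blocks, and all block volumes at most
    [Delta * s], where [Delta] is the maximum degree ([forest_partition]).  It
    is found by eating the forest leaf by leaf ([greedy_cut]).  A leaf carries
    the volume of what has already been merged into it.  If this is at least
    [s], the leaf is declared a finished block, which pays for the one edge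
    that is cut; otherwise it is merged into its neighbour.  A vertex thus
    receives at most [s - 1] from each of its neighbours, on top of its own
    degree, so no block exceeds [deg v + deg v * (s - 1) <= Delta * s].

    With [n] non-isolated vertices, [D >= n], and the two losses add up to at
    most [2 / s + Delta * s / n] ([forest_modularity]).  With [x] the square
    root of [Delta / n] this is at most [3 x] exactly when
    [(s x - 1) (s x - 2) <= 0], that is, when [s] lies between [1 / x] and
    [2 / x].  As [Delta <= n], that interval has length [1 / x >= 1] and
    contains an integer. *)

(** * Leaves of a forest *)

Section Graph.
Local Open Scope nat_scope.
Variable G : sgraph.
Implicit Types (S A : {set G}) (P : {set {set G}}).

Definition nbrs S (v : G) : {set G} := [set w in S | adj v w].

(** Ordered pairs are counted, so that for a symmetric relation every
    unordered edge contributes 2. *)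
Definition arcs S (r : rel G) : nat := \sum_(x in S) \sum_(y in S) r x y.

Definition vol S : nat := \sum_(v in S) deg v.

(** Walk through [S] without ever turning back: the walk can always be
    prolonged, and it cannot meet itself, since that would close a cycle of
    length at least 3. *)
Lemma path_of_nbrs_gt1 S (k : nat) : forest G -> S != set0 ->
    (forall v, v \in S -> 1 < #|nbrs S v|) ->
  exists x p, [/\ uniq (x :: p), path (@adj G) x p,
                  {subset x :: p <= S} & size p = k].
Proof.
move=> forG S0 deg2; elim: k => [|k [x [p [Up Pp Sp szp]]]].
  case/set0Pn: S0 => x xS; exists x, [::]; split=> // y.
  by rewrite inE => /eqP->.
have xS : x \in S by apply: Sp; rewrite mem_head.
have [z zN zp] : exists2 z, z \in nbrs S x & z != head x p.
  have : 0 < #|nbrs S x :\ head x p|.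
    by have := deg2 _ xS; rewrite (cardsD1 (head x p));
     case: (_ \in _) => [|/ltnW].
  by case/card_gt0P=> z; rewrite 2!inE => /andP[zp zN]; exists z.
move: zN; rewrite inE => /andP[zS xz].
have zx : z != x by apply: contraTneq xz => ->; rewrite adj_irrefl.
have [zinp | zninp] := boolP (z \in p); last first.
  exists z, (x :: p); split=> //=; last by rewrite szp.
  - by rewrite inE negb_or zx zninp.
  - by rewrite adj_sym xz.
  - by move=> y; rewrite inE => /predU1P[-> | /Sp].
(* The cycle is the walk from [x] back to [z]; it has a third vertex because
   [z] is not the predecessor of [x]. *)
exfalso; case/splitPr: zinp Up Pp zp {Sp szp} => p1 p2 Up Pp zp.
apply: (forG (x :: rcons p1 z)).
  by case: p1 zp {Up Pp} => [|a p1] /=; rewrite ?eqxx // size_rcons.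
rewrite -cat_rcons in Up Pp; move: Pp; rewrite cat_path => /andP[Pp _].
rewrite /ucycle /cycle rcons_path last_rcons Pp adj_sym xz.
by move: Up; rewrite -cat_cons cat_uniq => /and3P[].
Qed.

Lemma forest_leaf S : forest G -> S != set0 ->
  exists2 v, v \in S & #|nbrs S v| <= 1.
Proof.
move=> forG S0.
have [/exists_inP // | ] := boolP [exists v in S, #|nbrs S v| <= 1].
rewrite negb_exists_in => /forall_inP deg2.
have [|x [p [Up _ _ szp]]] := @path_of_nbrs_gt1 S #|G| forG S0.
  by move=> v vS; rewrite ltnNge deg2.
by have := max_card [in x :: p]; rewrite (card_uniqP Up) /= szp ltnn.
Qed.

(** * Greedy cutting *)

Lemma arcsD1 S (r : rel G) (v : G) : symmetric r -> r v v = false -> v \in S ->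
  arcs S r = 2 * (\sum_(y in S :\ v) r v y) + arcs (S :\ v) r.
Proof.
move=> rC rv vS; rewrite /arcs (big_setD1 v vS) /= (big_setD1 v vS) /= rv add0n.
under [X in _ + X = _]eq_bigr => x _ do rewrite (big_setD1 v vS) /= rC.
by rewrite big_split /= mul2n -addnn addnA.
Qed.

Lemma card_nbrs S (v : G) : v \in S -> #|nbrs S v| = \sum_(y in S :\ v) adj v y.
Proof.
move=> vS; rewrite -sum1_card big_mkcond [RHS]big_mkcond /=.
apply: eq_bigr => y _; rewrite !inE; case: eqVneq => [->|_] /=.
  by rewrite adj_irrefl andbF.
by case: (y \in S); case: (adj v y).
Qed.

Lemma nbrsD1 S (u v : G) : v \in S -> #|nbrs S u| = adj u v + #|nbrs (S :\ v) u|.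
Proof.
move=> vS; rewrite (cardsD1 v) inE vS /=; congr (_ + #|pred_of_set _|).
by apply/setP => y; rewrite !inE andbA.
Qed.

Definition cut (f : G -> G) : rel G := fun x y => adj x y && (f x != f y).

Lemma cutC f : symmetric (cut f).
Proof. by move=> x y; rewrite /cut adj_sym eq_sym. Qed.

Lemma cut_irrefl f : irreflexive (cut f).
Proof. by move=> x; rewrite /cut eqxx andbF. Qed.

(** The labelling [f] sends each vertex to a representative of its block; the
    condition that representatives stay in [S] makes a removed leaf a fresh
    label.  The weights are arbitrary so that the induction can move the weight
    of a small leaf to its neighbour.  In the hypothesis, each neighbour still
    present in [S] reserves room for the weight, at most [t], that it may later
    hand over; [M] bounds the block weights throughout. *)
Lemma greedy_cut (t M : nat) S (w : G -> nat) : forest G ->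
    (forall v, v \in S -> w v + #|nbrs S v| * t <= M) ->
  exists f : G -> G,
    [/\ forall v, v \in S -> f v \in S,
        forall x, \sum_(v in S | f v == x) w v <= M
      & t.+1 * arcs S (cut f) <= 2 * \sum_(v in S) w v].
Proof.
move=> forG; have [n] := ubnP #|S|.
elim: n S w => // n IHn S w leSn wM.
have [S0 | Sn0] := eqVneq S set0.
  exists id; split=> [//|x|].
    by rewrite S0 big_pred0 // => v; rewrite inE.
  by rewrite /arcs S0 !big_set0 !muln0.
have [v vS leaf_v] := forest_leaf S forG Sn0.
have ltS' : #|S :\ v| < n by move: leSn; rewrite (cardsD1 v) vS.
pose ext f (a : G) x := if x == v then a else f x.
have extE f a x : x \in S :\ v -> ext f a x = f x.
  by rewrite /ext !inE; case: eqP.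
have arcs_ext f a : arcs (S :\ v) (cut (ext f a)) = arcs (S :\ v) (cut f).
  apply: eq_bigr => x xS; apply: eq_bigr => y yS.
  by rewrite /cut !extE.
have extv f a : ext f a v = a by rewrite /ext eqxx.
have fiber (g : G -> nat) f a x : \sum_(y in S | ext f a y == x) g y =
    (if a == x then g v else 0) + \sum_(y in S :\ v | f y == x) g y.
  rewrite big_mkcondr (big_setD1 v vS) /= extv; congr (_ + _).
  by rewrite [RHS]big_mkcondr; apply: eq_bigr => y yS; rewrite extE.
(* A leaf of weight at most [t] is merged into its neighbour [u]. *)
have [/andP[wvt /card_gt0P[u]] | split_v] :=
    boolP ((w v <= t) && (0 < #|nbrs S v|)).
- rewrite inE => /andP[uS vu].
  have uv : u != v by apply: contraTneq vu => ->; rewrite adj_irrefl.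
  have uS' : u \in S :\ v by rewrite !inE uv.
  pose w' x := w x + (if x == u then w v else 0).
  have w'sum (Q : pred G) : \sum_(y in S :\ v | Q y) w' y =
      (if Q u then w v else 0) + \sum_(y in S :\ v | Q y) w y.
    rewrite big_split /= addnC; congr (_ + _).
    rewrite big_mkcondr (big_setD1 u uS') /= eqxx big1 ?addn0 // => y.
    by rewrite in_setD1 => /andP[/negbTE-> _]; rewrite if_same.
  have [|f [fS fM fcut]] := IHn (S :\ v) w' ltS'.
    move=> x xS'; have /wM : x \in S by case/setD1P: xS'.
    rewrite (nbrsD1 S x v vS) /w' mulnDl; case: eqVneq => [->|_]; last by lia.
    by rewrite adj_sym vu; lia.
  exists (ext f (f u)); split.
  + move=> x xS; rewrite /ext; case: eqVneq => [_|xv].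
      by case/setD1P: (fS _ uS').
    by have /fS/setD1P[] : x \in S :\ v by rewrite !inE xv.
  + by move=> x; rewrite fiber -(w'sum (fun y => f y == x)).
  rewrite (arcsD1 _ _ v (cutC _) (cut_irrefl _ _) vS) arcs_ext.
  rewrite (big_setD1 v vS) /=.
  move: (w'sum xpredT) fcut; rewrite !big_mkcondr /= => -> fcut.
  rewrite big1 ?muln0 ?add0n // => y yS; rewrite /cut extv extE //.
  have [vy|//] := boolP (adj v y).
  suff -> : y = u by rewrite eqxx.
  apply/eqP; apply: contraTT leaf_v => yu; rewrite -ltnNge.
  have <- : #|[set y; u]| = 2 by rewrite cards2 yu.
  apply/subset_leq_card/subsetP => z.
  by rewrite !inE => /orP[] /eqP->; [case/setD1P: yS => _ ->|rewrite uS].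
(* Otherwise [v] is a block: its weight is at least [t.+1], or it has no
   neighbour left and nothing is cut. *)
have [|f [fS fM fcut]] := IHn (S :\ v) w ltS'.
  move=> x xS'; have /wM : x \in S by case/setD1P: xS'.
  by apply: leq_trans; rewrite leq_add2l leq_mul2r (nbrsD1 S x v vS)
     leq_addl orbT.
exists (ext f v); split.
+ move=> x xS; rewrite /ext; case: eqVneq => [//|xv].
  by have /fS/setD1P[] : x \in S :\ v by rewrite !inE xv.
+ move=> x; rewrite fiber; case: eqVneq => [<-|_]; last by rewrite fM.
  rewrite big1 ?addn0; first by apply: leq_trans (wM v vS); exact: leq_addr.
  by move=> y /andP[/fS/setD1P[/negbTE->]].
rewrite (arcsD1 _ _ v (cutC _) (cut_irrefl _ _) vS) arcs_ext.
rewrite (big_setD1 v vS) /= mulnDr [leqRHS]mulnDr leq_add // mulnCA leq_mul2l /=.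
have le1 : \sum_(y in S :\ v) cut (ext f v) v y <= #|nbrs S v|.
  rewrite card_nbrs //; apply: leq_sum => y _.
  by rewrite /cut; case: (adj v y); case: (_ != _).
move: split_v le1 leaf_v; case: (#|nbrs S v|) => [|[|//]].
  by move=> _; rewrite leqn0 => /eqP->; rewrite muln0.
rewrite andbT -ltnNge => lt_tw le1 _; apply: leq_trans lt_tw.
by rewrite -[leqRHS]muln1 leq_mul2l le1 orbT.
Qed.

(** * Counting edges *)

Lemma deg_nbrs (v : G) : deg v = #|nbrs [set: G] v|.
Proof. by congr #|pred_of_set _|; apply/setP => w; rewrite !inE. Qed.

Lemma deg_sum (v : G) : deg v = \sum_(w in [set: G]) adj v w.
Proof.
rewrite deg_nbrs -sum1_card big_mkcond [RHS]big_mkcond.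
by apply: eq_bigr => y _; rewrite !inE /=; case: (adj v y).
Qed.

Lemma vol_setT : vol [set: G] = arcs [set: G] (@adj G).
Proof. by apply: eq_bigr => v _; rewrite deg_sum. Qed.

(** The map sending an ordered pair to the unordered one is two-to-one on
    adjacent pairs. *)
Lemma handshake A : arcs A (@adj G) = 2 * #|edges_in A|.
Proof.
pose D := [set p : G * G | [&& p.1 \in A, p.2 \in A & adj p.1 p.2]].
pose h (p : G * G) := [set p.1; p.2].
have -> : arcs A (@adj G) = #|D|.
  rewrite /arcs pair_big_dep /= -sum1_card big_mkcond [RHS]big_mkcond /=.
  apply: eq_bigr => p _; rewrite inE.
  by case: (p.1 \in A); case: (p.2 \in A); case: (adj _ _).
have hD p : p \in D -> h p \in edges_in A.
  rewrite !inE => /and3P[p1 p2 p12]; apply/andP; split.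
    by apply/imset2P; exists p.1 p.2; rewrite ?inE.
  by apply/subsetP => z; rewrite !inE => /orP[] /eqP->.
rewrite -sum1_card (partition_big h (mem (edges_in A))) //=.
rewrite mulnC -sum_nat_const; apply: eq_bigr => e.
rewrite inE => /andP[/imset2P[u v _]]; rewrite !inE /= => uv -> sA.
have uv' : u != v by apply: contraTneq uv => ->; rewrite adj_irrefl.
have [uA vA] : u \in A /\ v \in A.
  by split; apply: (subsetP sA); rewrite !inE eqxx ?orbT.
rewrite (eq_bigl (mem [set (u, v); (v, u)])).
  by rewrite sum1_card cards2 xpair_eqE (negbTE uv').
move=> [x y]; rewrite !inE /= !xpair_eqE; apply/andP/orP.
  case=> /and3P[xA yA xy] /eqP /setP E.
  have xy' : x != y by apply: contraTneq xy => ->; rewrite adj_irrefl.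
  have := E x; have := E y; rewrite !inE !eqxx orbT /=.
  move=> /esym/orP[] /eqP Ey /esym/orP[] /eqP Ex.
  - by rewrite Ex Ey eqxx in xy'.
  - by right; rewrite Ex Ey !eqxx.
  - by left; rewrite Ex Ey !eqxx.
  - by rewrite Ex Ey eqxx in xy'.
by case=> /andP[/eqP-> /eqP->]; rewrite uA vA ?(adj_sym v) uv // /h /= setUC.
Qed.

Lemma edges_in_setT : edges_in [set: G] = edges G.
Proof. by apply/setP => e; rewrite inE subsetT andbT. Qed.

Lemma vol_edges : vol [set: G] = 2 * #|edges G|.
Proof. by rewrite vol_setT handshake edges_in_setT. Qed.

Lemma deg_le_max (v : G) : deg v <= max_degree G.
Proof. exact: leq_bigmax. Qed.

(** * Partitions of a forest and their modularity *)

(** The last inequality, kept free of subtraction, says that [s] times the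
    number of edges between blocks is at most [vol [set: G]]; both sides are
    doubled. *)
Lemma forest_partition (s : nat) : forest G -> 0 < s ->
  exists P, [/\ partition P [set: G],
     forall A, A \in P -> vol A <= max_degree G * s
   & s * vol [set: G]
      <= s * (\sum_(A in P) 2 * #|edges_in A|) + 2 * vol [set: G]].
Proof.
case: s => // t forG _.
have [|f [_ fM fcut]] :=
    greedy_cut t (max_degree G * t.+1) [set: G] (@deg G) forG.
  (* With all neighbours present the reserved weight is exactly [deg v * s]. *)
  by move=> v _; rewrite -deg_nbrs -mulnS leq_mul2r deg_le_max orbT.
pose P := preim_partition f [set: G].
have partP : partition P [set: G] := preim_partitionP f _.
have PE A x : A \in P -> x \in A -> forall y, (y \in A) = (f y == f x).
  case/imsetP=> z _ ->; rewrite !inE /= => /eqP zx y.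
  by rewrite !inE /= zx eq_sym.
exists P; split=> // [A AP|].
  have [x xA] : exists x, x \in A.
    apply/set0Pn; case/and3P: partP => _ _; by apply: contraNneq => <-.
  apply: leq_trans (fM (f x)); rewrite /vol eq_leq //.
  by apply: eq_bigl => y; rewrite inE (PE A x).
apply: leq_trans (leq_add (leqnn _) fcut); rewrite -mulnDr leq_mul2l /=.
rewrite vol_setT eq_leq //.
under [in RHS]eq_bigr => A _ do rewrite -handshake.
rewrite /arcs (set_partition_big _ partP).
rewrite [X in _ + X](set_partition_big _ partP) /=.
rewrite -big_split; apply: eq_bigr => A AP; rewrite -big_split /=.
apply: eq_bigr => x xA.
rewrite [X in _ + X]big_mkcond [X in X + _]big_mkcond -big_split /=.
rewrite big_mkcond; apply: eq_bigr => y _.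
rewrite (PE A x AP xA) inE /cut eq_sym.
by case: eqP => _; rewrite ?andbT ?andbF ?addn0.
Qed.

Lemma card_non_isolated_le : #|non_isolated G| <= vol [set: G].
Proof.
rewrite -sum1_card /vol big_mkcond [leqRHS]big_mkcond; apply: leq_sum => v _.
by rewrite !inE; case: ifP => // /existsP[w vw];
   apply/card_gt0P; exists w; rewrite inE.
Qed.

Lemma max_degree_le : max_degree G <= #|non_isolated G|.
Proof.
apply/bigmax_leqP => v _; apply/subset_leq_card/subsetP => w; rewrite !inE => vw.
by apply/existsP; exists v; rewrite adj_sym.
Qed.

Lemma max_degree_gt0 : 0 < #|non_isolated G| -> 0 < max_degree G.
Proof.
case/card_gt0P=> v; rewrite inE => /existsP[w vw].
by apply: leq_trans (deg_le_max v); apply/card_gt0P; exists w; rewrite inE.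
Qed.

End Graph.

(** The first loss is the fraction of edges between blocks; the second is
    the volume bound [Delta * s] divided by the total volume, which is at least
    the number of non-isolated vertices. *)
Lemma forest_modularity (R : realType) (G : sgraph) (s : nat) :
  forest G -> (0 < s)%N -> (0 < #|non_isolated G|)%N ->
  1 - 2 / s%:R - (max_degree G)%:R * s%:R / #|non_isolated G|%:R
    <= modularity R G.
Proof.
move=> forG s0 n0; have [P [partP volP cutP]] := forest_partition G s forG s0.
apply: le_trans (modularity_ge R partP); rewrite /part_modularity.
have le_nD := card_non_isolated_le G.
have D_gt0 : (0 < vol G [set: G])%N := leq_trans n0 le_nD.
have DE : (vol G [set: G])%:R = 2 * #|edges G|%:R :> R.
  by rewrite vol_edges natrM.
set D := vol G [set: G] in le_nD D_gt0 DE cutP.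
set Delta := max_degree G in volP *; set n := #|non_isolated G| in n0 le_nD *.
have volsum : (\sum_(A in P) vol G A = D)%N.
  by rewrite /D /vol (set_partition_big _ partP).
pose E := (\sum_(A in P) 2 * #|edges_in A|)%N.
have -> : \sum_(A in P) (#|edges_in A|%:R / #|edges G|%:R
     - (\sum_(v in A) deg v)%N%:R ^+ 2 / (4 * #|edges G|%:R ^+ 2)) =
   E%:R / D%:R - (\sum_(A in P) vol G A ^ 2)%N%:R / D%:R ^+ 2 :> R.
  have m0 : #|edges G|%:R != 0 :> R.
    by apply: contraTneq D_gt0 => m0; rewrite -(ltr0n R) DE m0 mulr0 ltxx.
  rewrite DE /E !natr_sum !mulr_suml -sumrB; apply: eq_bigr => A _.
  by rewrite natrM natrX /vol; field.
have sqP : (\sum_(A in P) vol G A ^ 2 <= Delta * s * D)%N.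
  rewrite -volsum big_distrr /=; apply: leq_sum => A AP.
  by rewrite -mulnn leq_mul2r volP ?orbT.
have s_gt0 : 0 < s%:R :> R by rewrite ltr0n.
have n_gt0 : 0 < n%:R :> R by rewrite ltr0n.
have DR_gt0 : 0 < D%:R :> R by rewrite ltr0n.
have cutR : s%:R * D%:R <= s%:R * E%:R + 2 * D%:R :> R.
  by rewrite -!natrM -natrD ler_nat.
have sqR : (\sum_(A in P) vol G A ^ 2)%N%:R <= Delta%:R * s%:R * D%:R :> R.
  by rewrite -!natrM ler_nat.
apply: lerB.
  rewrite ler_pdivlMr // -(ler_pM2l s_gt0) mulrA mulrBr mulr1 mulrCA.
  by rewrite mulfV ?gt_eqF // mulr1 mulrBl lerBlDr.
apply: (@le_trans _ _ (Delta%:R * s%:R / D%:R)).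
  by rewrite ler_pdivrMr ?exprn_gt0 // expr2 mulrA divfK ?gt_eqF.
by rewrite ler_wpM2l ?mulr_ge0 // lef_pV2 ?posrE // ler_nat.
Qed.

Theorem theorem5 (R : realType) (F : nat -> sgraph)
  (F_forest : forall n : nat, (2 <= n)%N -> forest (F n))
  (F_order : forall n : nat, (2 <= n)%N -> #|non_isolated (F n)| = n) :
  forall n : nat, (2 <= n)%N ->
    modularity R (F n) >= 1 - 3 * Num.sqrt ((max_degree (F n))%:R / n%:R).
Proof.
move=> n n2; have := F_forest n n2; have := F_order n n2.
move: (F n) => G nG forG; have n0 : (0 < n)%N by apply: leq_trans n2.
rewrite -{n}nG in n2 n0 *; set n := #|_| in n2 n0 *.
have Delta0 : (0 < max_degree G)%N by apply: max_degree_gt0.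
have Delta_n : (max_degree G <= n)%N by apply: max_degree_le.
have n_gt0 : 0 < n%:R :> R by rewrite ltr0n.
have D_gt0 : 0 < (max_degree G)%:R :> R by rewrite ltr0n.
set Delta := max_degree G in Delta0 Delta_n D_gt0 *.
pose x : R := Num.sqrt (Delta%:R / n%:R).
have x_gt0 : 0 < x by rewrite sqrtr_gt0 divr_gt0.
have x2 : x ^+ 2 = Delta%:R / n%:R by rewrite sqr_sqrtr // divr_ge0 // ltW.
have x_le1 : x <= 1.
  by rewrite -[leRHS]sqrtr1 ler_wsqrtr // ler_pdivrMr // mul1r ler_nat.
rewrite -/x; have xV_ge0 : 0 <= x^-1 by rewrite invr_ge0 ltW.
(* The least integer above [1 / x]; it is at most [1 / x + 1 <= 2 / x]. *)
pose s := (Num.truncn x^-1).+1.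
have /andP[s_le s_gt] := truncn_itv xV_ge0.
apply: le_trans (forest_modularity R G s forG _ n0) => //.
rewrite -/n -/Delta mulrAC -x2.
have sx1 : 1 <= s%:R * x by rewrite -ler_pdivrMr // div1r ltW.
have sx2 : s%:R * x <= 2.
  by rewrite -ler_pdivlMr // mulr_natl mulr2n /s -natr1 lerD // invf_ge1.
have s_gt0 : 0 < s%:R :> R by rewrite ltr0n.
suff : 2 / s%:R + x ^+ 2 * s%:R <= 3 * x by lra.
rewrite -(ler_pM2r s_gt0) mulrDl divfK ?gt_eqF //.
(* This is [(s x - 1) (s x - 2) <= 0]. *)
nra.
Qed.
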